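(* Let $M$ be a $C^{1,1}$ submanifold of $\mathbb{R}^d$ with frontier function $\vartheta:\nu_1(M)\to(0,\infty]$. Then $\operatorname{reach}(M)\le\inf\{\vartheta(\xi,v):(\xi,v)\in\nu_1(M)\}$, with equality if $M$ is a closed subset of $\mathbb{R}^d$. In particular, if $M$ is compact, then $\operatorname{reach}(M)=\min\{\vartheta(\xi,v):(\xi,v)\in\nu_1(M)\}>0$.
   Context: Submanifolds are nonempty. Let $0\le m<d$. A set $M\subseteq\mathbb{R}^d$ is an $m$-dimensional $C^k$ submanifold of $\mathbb{R}^d$ if for every $\xi\in M$ there are open sets $U,V\subseteq\mathbb{R}^d$ with $\xi\in U$ and a $C^k$ diffeomorphism $\Psi:V\to U$ such that for all $y\in V$: $\Psi(y)\in M\iff y_{m+1}=\dots=y_d=0$. The case $m=d$ is excluded throughout. $T_\xi(M)$ denotes the tangent space (a linear subspace of $\mathbb{R}^d$). Let $S$ be the unit sphere of $\mathbb{R}^d$. For $m$-dimensional linear subspaces $T_1,T_2$ put $d_H(T_1,T_2):=\sup_{t_1\in T_1\cap S}\inf_{t_2\in T_2\cap S}\|t_2-t_1\|$. For $m\ge1$, $M$ is an $m$-dimensional $C^{1,1}$ submanifold if it is an $m$-dimensional $C^1$ submanifold and $\xi\mapsto T_\xi(M)$ is locally Lipschitz with respect to $d_H$: every point of $M$ has a relatively open neighborhood $V\subseteq M$ and a constant $L>0$ with $d_H(T_\zeta(M),T_\eta(M))\le L\|\zeta-\eta\|$ for all $\zeta,\eta\in V$. $d(x,M)=\inf_{\xi\in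 M}\|x-\xi\|$ (Euclidean norm), $M^\varepsilon:=\{x\in\mathbb{R}^d:d(x,M)<\varepsilon\}$. $\operatorname{unpp}(M)$ is the set of $x\in\mathbb{R}^d$ for which there is exactly one $\xi\in M$ with $\|x-\xi\|=d(x,M)$. $\mathcal{E}(M)$ is the interior of $\operatorname{unpp}(M)$. $\operatorname{reach}(M):=\sup\{\varepsilon\in(0,\infty):M^\varepsilon\subseteq\operatorname{unpp}(M)\}\in[0,\infty]$, with the supremum of the empty set being $0$. $\nu_1(M):=\{(\xi,v)\in\mathbb{R}^d\times\mathbb{R}^d:\xi\in M,\ v\perp T_\xi(M),\ \|v\|=1\}$. The frontier function is $\vartheta(\xi,v):=\sup\{r>0:\ ]\xi,\xi+rv[\ \subseteq\mathcal{E}(M)\}\in(0,\infty]$, where $]a,b[$ is the open line segment $\{(1-\lambda)a+\lambda b:\lambda\in(0,1)\}$. *)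

(* Defs.v *)
From HB Require Import structures.
From mathcomp Require Import all_boot all_order all_algebra.
From mathcomp Require Import all_classical all_reals all_analysis.
Set Implicit Arguments.
Unset Strict Implicit.
Unset Printing Implicit Defensive.
Import Order.TTheory GRing.Theory Num.Theory.
Import numFieldNormedType.Exports.

Local Open Scope classical_set_scope.
Local Open Scope ring_scope.

(* R^d is 'rV[R]_d. The library norm on 'rV[R]_d is the sup norm; it is used
   only through the topology and the differential, which are the same for all
   norms. All metric notions below use [enorm]. *)

Definition dotp (R : realType) (d : nat) (u v : 'rV[R]_d) : R :=
  \sum_(i < d) u 0 i * v 0 i.

Definition enorm (R : realType) (d : nat) (u : 'rV[R]_d) : R :=
  Num.sqrt (dotp u u).

Definition usphere (R : realType) (d : nat) : set 'rV[R]_d :=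
  [set u | enorm u = 1].

(* Meant for open A and finite-dimensional E, where continuity of
   y |-> 'd f y h for every h is continuity of y |-> 'd f y. *)
Definition C1_on (R : realType) (E F : normedModType R) (A : set E)
    (f : E -> F) : Prop :=
  forall x, A x ->
    differentiable f x /\ forall h : E, {for x, continuous (fun y => 'd f y h)}.

(* The values of Psi outside V are irrelevant. *)
Definition C1_diffeo (R : realType) (d : nat) (V U : set 'rV[R]_d)
    (Psi : 'rV[R]_d -> 'rV[R]_d) : Prop :=
  exists Phi : 'rV[R]_d -> 'rV[R]_d,
    [/\ C1_on V Psi, C1_on U Phi,
        forall y, V y -> U (Psi y) /\ Phi (Psi y) = y
      & forall x, U x -> V (Phi x) /\ Psi (Phi x) = x].

(* Coordinates are numbered from 0, so y_{m+1}, ..., y_d are the y 0 i with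
   m <= i. *)
Definition C1_submanifold (R : realType) (d m : nat) (M : set 'rV[R]_d) : Prop :=
  [/\ (m < d)%N, M !=set0
    & forall xi, M xi ->
        exists (U V : set 'rV[R]_d) (Psi : 'rV[R]_d -> 'rV[R]_d),
          [/\ open U, open V, U xi, C1_diffeo V U Psi
            & forall y, V y ->
                (M (Psi y) <-> forall i : 'I_d, (m <= i)%N -> y 0 i = 0)]].

(* Velocities at xi of the C^1 curves in M through xi. *)
Definition tangent (R : realType) (d : nat) (M : set 'rV[R]_d)
    (xi : 'rV[R]_d) : set 'rV[R]_d :=
  [set v | exists (e : R) (gamma : R -> 'rV[R]_d),
     [/\ 0 < e, C1_on `]- e, e[ gamma,
         forall t, t \in `]- e, e[ -> M (gamma t),
         gamma 0 = xi & derive1 gamma 0 = v]].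

(* The real [sup] and [inf] are the true ones when T1 and T2 are linear
   subspaces of positive dimension: the sets are then nonempty and bounded. *)
Definition dH (R : realType) (d : nat) (T1 T2 : set 'rV[R]_d) : R :=
  sup [set inf [set enorm (t2 - t1) | t2 in T2 `&` @usphere R d]
      | t1 in T1 `&` @usphere R d].

Definition C11_submanifold (R : realType) (d m : nat) (M : set 'rV[R]_d) : Prop :=
  [/\ (1 <= m)%N, C1_submanifold m M
    & forall xi, M xi ->
        exists (W : set 'rV[R]_d) (L : R),
          [/\ open W, W xi, 0 < L
            & forall zeta eta, (M `&` W) zeta -> (M `&` W) eta ->
                dH (tangent M zeta) (tangent M eta) <= L * enorm (zeta - eta)]].

Definition dist (R : realType) (d : nat) (x : 'rV[R]_d) (M : set 'rV[R]_d) : R :=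
  inf [set enorm (x - xi) | xi in M].

Definition tube (R : realType) (d : nat) (M : set 'rV[R]_d) (e : R) :
    set 'rV[R]_d :=
  [set x | dist x M < e].

Definition unpp (R : realType) (d : nat) (M : set 'rV[R]_d) : set 'rV[R]_d :=
  [set x | exists! xi, M xi /\ enorm (x - xi) = dist x M].

Definition unpp_int (R : realType) (d : nat) (M : set 'rV[R]_d) : set 'rV[R]_d :=
  interior (unpp M).

(* [ereal_sup set0] is -oo; the maximum with 0 makes the supremum of the empty
   set 0 and changes nothing otherwise. *)
Definition reach (R : realType) (d : nat) (M : set 'rV[R]_d) : \bar R :=
  maxe 0%E (ereal_sup [set e%:E | e in [set e : R | 0 < e /\ tube M e `<=` unpp M]]).

Definition unit_normal (R : realType) (d : nat) (M : set 'rV[R]_d) :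
    set ('rV[R]_d * 'rV[R]_d) :=
  [set p | [/\ M p.1, forall t, tangent M p.1 t -> dotp p.2 t = 0
             & enorm p.2 = 1]].

Definition open_segment (R : realType) (d : nat) (a b : 'rV[R]_d) :
    set 'rV[R]_d :=
  [set (1 - l) *: a + l *: b | l in `]0, 1[].

(* No convention is imposed for the empty supremum, which is -oo here. *)
Definition frontier_fun (R : realType) (d : nat) (M : set 'rV[R]_d)
    (p : 'rV[R]_d * 'rV[R]_d) : \bar R :=
  ereal_sup [set r%:E | r in
    [set r : R | 0 < r /\ open_segment p.1 (p.1 + r *: p.2) `<=` unpp_int M]].

(* Main.v *)
(* Along a chart segment from a to b in M, the velocity lies in the tangent
   spaces, which turn by at most L times the distance; by the mean value theorem
   <u, b - a> <= K |u| |b - a|^2 near any point of M, for u normal at a. If a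
   and b are both nearest to x, then x - a is normal at a and
   <x - a, b - a> = |b - a|^2 / 2, so a = b as soon as K |x - a| < 1/2. Hence M
   lies in the interior E(M) of unpp(M), so theta > 0; and if the open set M^e is
   contained in unpp(M), it is contained in E(M), so theta >= e.
   If M is closed, a point x at distance r < inf theta from M lies on the normal
   ray of a nearest point, at parameter r, hence in E(M).
   If M is compact, a pair realizing the distance from M to the complement of
   E(M) yields a unit normal at which theta is at most that distance, while the
   distance is itself at most reach(M). *)
Require Import Defs.
From HB Require Import structures.
From mathcomp Require Import all_boot all_order all_algebra.
From mathcomp Require Import all_classical all_reals all_analysis.
From mathcomp Require Import ring lra.
Set Implicit Arguments.
Unset Strict Implicit.
Unset Printing Implicit Defensive.
Import Order.TTheory GRing.Theory Num.Theory.
Import numFieldNormedType.Exports.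

Local Open Scope classical_set_scope.
Local Open Scope ring_scope.

(** * Euclidean inner product and norm, and their agreement with the library topology *)

Section Euclidean.
Context {R : realType} {d : nat}.
Implicit Types u v w x y c : 'rV[R]_d.

Lemma dotpC u v : dotp u v = dotp v u.
Proof. by apply: eq_bigr => i _; rewrite mulrC. Qed.

Lemma dotpDr u v w : dotp u (v + w) = dotp u v + dotp u w.
Proof. by rewrite -big_split; apply: eq_bigr => i _ /=; rewrite mxE mulrDr. Qed.

Lemma dotpZr a u v : dotp u (a *: v) = a * dotp u v.
Proof. by rewrite mulr_sumr; apply: eq_bigr => i _; rewrite mxE mulrCA. Qed.

Lemma dotpNr u v : dotp u (- v) = - dotp u v.
Proof. by rewrite -scaleN1r dotpZr mulN1r. Qed.

Lemma dotpBr u v w : dotp u (v - w) = dotp u v - dotp u w.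
Proof. by rewrite dotpDr dotpNr. Qed.

Lemma dotpDl u v w : dotp (u + v) w = dotp u w + dotp v w.
Proof. by rewrite dotpC dotpDr !(dotpC w). Qed.

Lemma dotpZl a u v : dotp (a *: u) v = a * dotp u v.
Proof. by rewrite dotpC dotpZr dotpC. Qed.

Lemma dotpNl u v : dotp (- u) v = - dotp u v.
Proof. by rewrite dotpC dotpNr dotpC. Qed.

Lemma dotpBl u v w : dotp (u - v) w = dotp u w - dotp v w.
Proof. by rewrite dotpDl dotpNl. Qed.

Lemma dotp_ge0 u : 0 <= dotp u u.
Proof. by apply: sumr_ge0 => i _; rewrite -expr2 sqr_ge0. Qed.

Lemma enorm_ge0 u : 0 <= enorm u. Proof. exact: sqrtr_ge0. Qed.

Lemma enorm_sqr u : enorm u ^+ 2 = dotp u u.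
Proof. by rewrite sqr_sqrtr // dotp_ge0. Qed.

Lemma enormZ a u : enorm (a *: u) = `|a| * enorm u.
Proof.
by rewrite /enorm dotpZl dotpZr mulrA -expr2 sqrtrM ?sqr_ge0 // sqrtr_sqr.
Qed.

Lemma enormN u : enorm (- u) = enorm u.
Proof. by rewrite /enorm dotpNl dotpNr opprK. Qed.

Lemma enormBC u v : enorm (u - v) = enorm (v - u).
Proof. by rewrite -opprB enormN. Qed.

Lemma coord_le_enorm u i : `|u 0 i| <= enorm u.
Proof.
rewrite -sqrtr_sqr ler_wsqrtr // /dotp (bigD1 i) //= -expr2 lerDl.
by apply: sumr_ge0 => j _; rewrite -expr2 sqr_ge0.
Qed.

Lemma enorm0 : enorm (0 : 'rV[R]_d) = 0.
Proof. by rewrite -(scale0r 0) enormZ normr0 mul0r. Qed.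

Lemma enorm_eq0 u : (enorm u == 0) = (u == 0).
Proof.
apply/eqP/eqP => [u0|->]; last exact: enorm0.
apply/rowP => i; apply/eqP; rewrite mxE -normr_le0 -u0; exact: coord_le_enorm.
Qed.

Lemma enorm_gt0 u : (0 < enorm u) = (u != 0).
Proof. by rewrite lt_def enorm_ge0 enorm_eq0 andbT. Qed.

(** Cauchy-Schwarz: with a = |u| and b = |v| nonzero, expanding |b u - a v|^2 >= 0 gives 2ab(ab -
    <u, v>) >= 0. *)
Lemma dotp_le_enorm u v : dotp u v <= enorm u * enorm v.
Proof.
have [->|u0] := eqVneq u 0.
  by rewrite enorm0 mul0r -(scale0r 0) dotpZl mul0r.
have [->|v0] := eqVneq v 0.
  by rewrite enorm0 mulr0 -(scale0r 0) dotpZr mul0r.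
have pu : 0 < enorm u by rewrite enorm_gt0.
have pv : 0 < enorm v by rewrite enorm_gt0.
have := dotp_ge0 (enorm v *: u - enorm u *: v).
rewrite !(dotpBl, dotpBr, dotpZl, dotpZr) (dotpC v u) -!enorm_sqr.
set a := enorm u in pu *; set b := enorm v in pv *.
rewrite (_ : _ - _ = 2 * (a * b) * (a * b - dotp u v)); last by ring.
by rewrite pmulr_rge0 ?subr_ge0 // !mulr_gt0.
Qed.

Lemma ler_enormD u v : enorm (u + v) <= enorm u + enorm v.
Proof.
rewrite -(@ler_pXn2r _ 2) ?nnegrE ?addr_ge0 ?enorm_ge0 // sqrrD !enorm_sqr.
rewrite dotpDl !dotpDr (dotpC v u); have := dotp_le_enorm u v; lra.
Qed.

Lemma ler_enormB x y c : enorm (x - y) <= enorm (x - c) + enorm (y - c).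
Proof.
rewrite (enormBC y); apply: le_trans (ler_enormD _ _).
by rewrite addrA subrK.
Qed.

Lemma ler_enorm_sum (I : Type) (r : seq I) (F : I -> 'rV[R]_d) :
  enorm (\sum_(i <- r) F i) <= \sum_(i <- r) enorm (F i).
Proof.
elim/big_ind2 : _ => [|a b e f ab ef|//]; first by rewrite enorm0.
exact: le_trans (ler_enormD _ _) (lerD ab ef).
Qed.

Lemma continuous_dotp u : continuous (dotp u).
Proof.
apply: (continuous_big add_continuous) => i _ x.
by apply: continuousM; [exact: cst_continuous|exact: coord_continuous].
Qed.

Lemma continuous_enorm : continuous (@enorm R d).
Proof.
move=> x; apply: (@continuous_comp _ _ _ (fun u => dotp u u) Num.sqrt).
  apply: (continuous_big add_continuous) => i _ y.
  by apply: continuousM; exact: coord_continuous.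
exact: sqrt_continuous.
Qed.

Lemma continuous_edist c : continuous (fun x => enorm (x - c)).
Proof.
move=> x; apply: (@continuous_comp _ _ _ (fun x => x - c) (@enorm R d)).
  by apply: continuousB; [exact: cvg_id|exact: cst_continuous].
exact: continuous_enorm.
Qed.

(** Bridge from the sup-norm topology to Euclidean balls: the sup norm is at most [enorm], and
    conversely [enorm] is continuous. *)
Lemma nbhs_enormP x (A : set 'rV[R]_d) :
  nbhs x A <-> exists2 r, 0 < r & forall y, enorm (y - x) < r -> A y.
Proof.
split=> [/nbhs_normP[r r0 rA]|[r r0 rA]].
  exists r => // y yx; apply: rA; apply: le_lt_trans yx.
  rewrite distrC [leLHS]/Num.Def.normr/= mx_normrE.
  by apply: bigmax_le => [|[i j] _]; rewrite ?enorm_ge0 // ord1 coord_le_enorm.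
have H : nbhs x ((fun y => enorm (y - x)) @^-1` ball (enorm (x - x)) r).
  exact: (@continuous_edist x x _ (nbhsx_ballx _ _ r0)).
apply: filterS H => y; rewrite /= subrr enorm0 /ball /= sub0r.
by rewrite normrN ger0_norm ?enorm_ge0 //; exact: rA.
Qed.

Lemma open_eball c r : open [set x : 'rV[R]_d | enorm (x - c) < r].
Proof.
apply: (@open_comp _ _ (fun x => enorm (x - c)) [set t | t < r]).
  by move=> x _; exact: continuous_edist.
exact: open_lt.
Qed.

Lemma closed_eball c r : closed [set x : 'rV[R]_d | enorm (x - c) <= r].
Proof.
apply: (@preimage_closed _ _ (fun x => enorm (x - c)) [set t | t <= r]).
  by move=> x _; exact: continuous_edist.
exact: closed_le.
Qed.

Lemma compact_eball (A : set 'rV[R]_d) c r :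
  closed A -> A `<=` [set x | enorm (x - c) <= r] -> compact A.
Proof.
move=> cA Ar; apply: bounded_closed_compact cA.
exists (enorm c + r); split=> [|s ls x /Ar /= xr]; first exact: num_real.
rewrite [leLHS]/Num.Def.normr/= mx_normrE; apply: bigmax_le => [|[i j] _].
  by apply: le_trans (ltW ls); rewrite addr_ge0 ?enorm_ge0 ?(le_trans _ xr) ?enorm_ge0.
rewrite ord1; apply: le_trans (coord_le_enorm _ _) _.
apply: le_trans (ltW ls); rewrite -[X in enorm X](subrK c) addrC.
by apply: le_trans (ler_enormD _ _) _; rewrite lerD2l.
Qed.

End Euclidean.

(** * Mean value theorem and local Lipschitz bounds for C^1 maps *)

Section Calculus.
Context {R : realType}.

Lemma diff_dotp {d : nat} (E : normedModType R) (u : 'rV[R]_d) (f : E -> 'rV[R]_d) x :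
  differentiable f x ->
  is_diff x (fun y => dotp u (f y)) (fun h => dotp u ('d f x h)).
Proof.
move=> df.
have lin : linear (dotp u : 'rV[R]_d -> R).
  by move=> a v w; rewrite dotpDr dotpZr.
pose linM := GRing.isLinear.Build _ _ _ _ _ lin.
pose L : {linear 'rV[R]_d -> R} := HB.pack (dotp u : 'rV[R]_d -> R) linM.
have cL : continuous L by exact: continuous_dotp.
have dL y : differentiable L y by exact: linear_differentiable.
apply: DiffDef; first exact: (@differentiable_comp _ _ _ _ f L).
by rewrite (@diff_comp _ _ _ _ f L) // diff_lin.
Qed.

Lemma diff_line (E : normedModType R) (p h : E) (s : R) :
  is_diff s (fun t : R => p + t *: h) (fun k => k *: h).
Proof.
have dc : is_diff s (cst p : R -> E) 0 by exact: is_diff_cst.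
have ds : is_diff s ( *:%R ^~ h : R -> E) ( *:%R ^~ h) by exact: is_diff_scalel.
by apply: is_diff_eq (is_diffD dc ds) _; rewrite add0r.
Qed.

Lemma diff_along_line (E F : normedModType R) (f : E -> F) (p h : E) (s : R) :
  differentiable f (p + s *: h) ->
  is_diff s (fun t : R => f (p + t *: h)) (fun k => 'd f (p + s *: h) (k *: h)).
Proof.
move=> df; have dl := diff_line p h s.
have dfl : is_diff (p + s *: h) f ('d f (p + s *: h)) by apply: DiffDef.
exact: (@is_diff_comp _ _ _ _ _ _ _ _ _ dl dfl).
Qed.

(* Testing [f y - f x] against a fixed vector [u] reduces the vector-valued
   mean value theorem to the scalar one. *)
Lemma dotp_MVT {d : nat} (E : normedModType R) (f : E -> 'rV[R]_d) (u : 'rV[R]_d) x y :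
  (forall s : R, 0 <= s <= 1 -> differentiable f (x + s *: (y - x))) ->
  exists2 s : R, 0 < s < 1 &
    dotp u (f y - f x) = dotp u ('d f (x + s *: (y - x)) (y - x)).
Proof.
move=> df.
pose g (s : R) : R := dotp u (f (x + s *: (y - x))).
have dg (s : R) : 0 <= s <= 1 ->
    is_derive s 1 g (dotp u ('d f (x + s *: (y - x)) (y - x))).
  move=> /df /diff_along_line [d1 d2].
  have [e1 e2] := diff_dotp u d1.
  apply: DeriveDef; first by apply/derivable1_diffP.
  by rewrite deriveE // e2 d2 scale1r.
have [||s s01] :=
  @MVT R g (fun s : R => dotp u ('d f (x + s *: (y - x)) (y - x))) 0 1 ltr01.
- by move=> s /itvP s01; apply: dg; rewrite !s01.
- apply: derivable_within_continuous => s /itvP s01.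
  by have [] : is_derive s 1 g _ := dg _ _; rewrite ?s01.
rewrite subr0 mulr1 {1 2}/g scale1r scale0r addr0 (addrC x) subrK => e.
by exists s; rewrite ?dotpBr // !(itvP s01).
Qed.

(** Expanding h in the standard basis bounds |['d f y h]| by |h| times the sum [B y] of the norms of
    the images of the basis vectors; [B] is continuous at p, hence below [B p + 1] nearby. *)
Lemma C1_diff_bound {n d : nat} (A : set 'rV[R]_n) (f : 'rV[R]_n -> 'rV[R]_d) p :
  C1_on A f -> A p ->
  exists2 C, 0 < C &
    \forall y \near p, forall h, enorm ('d f y h) <= C * enorm h.
Proof.
move=> Cf Ap; have [_ cdf] := Cf p Ap.
pose B y := \sum_(i < n) enorm ('d f y (delta_mx 0 i)).
have cB : {for p, continuous B}.
  apply: (@cvg_big _ _ _ _ _ add_continuous _ _ _ _ _ (nbhs_filter p)) => i _.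
  apply: (@continuous_comp _ _ _ (fun y => 'd f y (delta_mx 0 i)) (@enorm R d)).
    exact: cdf.
  exact: continuous_enorm.
have B0 y : 0 <= B y by apply: sumr_ge0 => i _; exact: enorm_ge0.
exists (B p + 1); first by rewrite ltr_wpDl.
have : \forall y \near p, B y < B p + 1.
  by apply: (cvgr_lt _ cB); rewrite ltrDl.
apply: filterS => y Byp h.
rewrite {1}(row_sum_delta h) linear_sum; apply: le_trans (ler_enorm_sum _ _) _.
rewrite mulrC; apply: le_trans (ler_wpM2l (enorm_ge0 _) (ltW Byp)).
rewrite mulr_sumr; apply: ler_sum => i _; rewrite linearZ enormZ.
by apply: ler_wpM2r; [exact: enorm_ge0|exact: coord_le_enorm].
Qed.

Lemma eball_convex {n : nat} (p x y : 'rV[R]_n) (r s : R) :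
  enorm (x - p) < r -> enorm (y - p) < r -> 0 <= s <= 1 ->
  enorm (x + s *: (y - x) - p) < r.
Proof.
move=> xr yr /andP[s0 s1].
have -> : x + s *: (y - x) - p = (1 - s) *: (x - p) + s *: (y - p).
  by apply/rowP => i; rewrite !mxE; ring.
apply: le_lt_trans (ler_enormD _ _) _; rewrite !enormZ !ger0_norm ?subr_ge0 //.
have [->|s0'] := eqVneq s 0; first by rewrite subr0 mul1r mul0r addr0.
have sp : 0 < s by rewrite lt_def s0' s0.
have := enorm_ge0 (x - p); nra.
Qed.

Lemma C1_locally_lipschitz {n d : nat} (A : set 'rV[R]_n)
    (f : 'rV[R]_n -> 'rV[R]_d) (p : 'rV[R]_n) :
  C1_on A f -> nbhs p A ->
  exists2 C : R, 0 < C & exists2 r : R, 0 < r &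
    [/\ forall y : 'rV[R]_n, enorm (y - p) < r -> A y,
        forall y h : 'rV[R]_n, enorm (y - p) < r -> enorm ('d f y h) <= C * enorm h
      & forall x y : 'rV[R]_n, enorm (x - p) < r -> enorm (y - p) < r ->
          enorm (f y - f x) <= C * enorm (y - x)].
Proof.
move=> Cf nA; have [C C0 nC] := C1_diff_bound Cf (nbhs_singleton nA).
have /nbhs_enormP[r r0 rA] :
    nbhs p (A `&` [set y | forall h, enorm ('d f y h) <= C * enorm h]).
  exact: filterI.
exists C => //; exists r => //; split=> [y /rA[]//|y h /rA[_]|x y xr yr]; first exact.
(* Testing against [f y - f x] itself gives |f y - f x|^2 on the left; Cauchy-Schwarz then allows
   one factor to be cancelled. *)
have [|s s01 e] := @dotp_MVT d _ f (f y - f x) x y.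
  by move=> s s01; have [/Cf[]] := rA _ (eball_convex xr yr s01).
have s01' : 0 <= s <= 1 by case/andP: s01 => /ltW -> /ltW ->.
have [_ /(_ (y - x)) bd] := rA _ (eball_convex xr yr s01').
have [->|ne] := eqVneq (f y - f x) 0.
  by rewrite enorm0 mulr_ge0 ?enorm_ge0 ?ltW.
apply: le_trans bd; rewrite -(@ler_pM2l _ (enorm (f y - f x))) ?enorm_gt0 //.
by rewrite -expr2 enorm_sqr e dotp_le_enorm.
Qed.

End Calculus.

Lemma near_continuous (T U : topologicalType) (f g : T -> U) (x : T) :
  (\forall y \near x, f y = g y) -> {for x, continuous f} -> {for x, continuous g}.
Proof.
move=> fg cf; rewrite /prop_for /continuous_at -(nbhs_singleton fg).
by apply: cvg_trans cf; apply: near_eq_cvg.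
Qed.

(** * Tangent vectors, normals at nearest points, and charts *)

Section TangentSpaces.
Context {R : realType} {d : nat}.
Implicit Types (M : set 'rV[R]_d) (x u : 'rV[R]_d).

Lemma is_derive_coord (c : R -> 'rV[R]_d) (s : R) i :
  differentiable c s -> is_derive s 1 (fun t => c t 0 i) ('d c s 1 0 i).
Proof.
move=> dc; have Dc : derivable c s 1 by apply/derivable1_diffP.
apply: DeriveDef; first by move/derivable_mxP : Dc.
by rewrite -deriveE // derive_mx // mxE.
Qed.

(** Along a C^1 curve c in M through xi, |x - c(s)|^2 is minimal at s = 0, so its derivative -2 <x -
    c, c'> vanishes there. *)
Lemma nearest_normal M x xi t :
  (forall eta, M eta -> enorm (x - xi) <= enorm (x - eta)) ->
  tangent M xi t -> dotp (x - xi) t = 0.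
Proof.
move=> near_xi [e [c [e0 C1c Mc c0 c't]]].
have dc s : s \in `]- e, e[ -> differentiable c s by move=> /C1c[].
have dco s : s \in `]- e, e[ ->
    is_derive s 1 (fun s => dotp (x - c s) (x - c s))
      (- 2 * dotp (x - c s) ('d c s 1)).
  move=> /dc dcs; pose f i : R -> R := cst (x 0 i) - (fun t => c t 0 i).
  have -> : (fun s => dotp (x - c s) (x - c s)) = \sum_(i < d) f i * f i.
    apply/funext => s'; rewrite fct_sumE; apply: eq_bigr => i _.
    by rewrite !mxE.
  rewrite mulr_sumr; apply: is_derive_sum => i.
  have dci := is_derive_coord i dcs.
  have dcst : is_derive s (1 : R) (cst (x 0 i)) 0 by exact: is_derive_cst.
  have df := is_deriveB dcst dci.
  apply: is_derive_eq (is_deriveM df df) _.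
  by rewrite !mxE !fctE /= sub0r /GRing.scale /=; ring.
have e_0 : 0 \in `]- e, e[ by rewrite in_itv /= oppr_lt0 e0.
have [_ D0] : is_derive (0 : R) (1 : R) (fun s : R => dotp (x - c s) (x - c s)) 0.
  apply: (@derive1_at_min R _ (- e) e) e_0 _.
  - by rewrite ge0_cp // ltW.
  - by move=> s /dco[].
  - move=> s se; rewrite -!enorm_sqr c0; apply: lerXn2r.
    + exact: enorm_ge0.
    + exact: enorm_ge0.
    + by apply: near_xi; apply: Mc.
have ct : 'd c 0 1 = t by rewrite -c't derive1E' //; exact: dc.
have [_] := dco _ e_0; rewrite D0 c0 ct => /esym/eqP.
by rewrite mulf_eq0 oppr_eq0 pnatr_eq0 /= => /eqP.
Qed.

(** For every unit s in T2, <u, t> = <u, t - s> <= |u| |t - s|; the infimum over s is one of the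
    values whose supremum is [dH T1 T2]. *)
Lemma dotp_le_dH (T1 T2 : set 'rV[R]_d) u t :
  T2 `&` @usphere R d !=set0 -> T1 t -> enorm t = 1 ->
  (forall s, T2 s -> dotp u s = 0) -> dotp u t <= enorm u * dH T1 T2.
Proof.
move=> [t2 [T2t2 t21]] T1t t1 uT2.
pose g t := inf [set enorm (t2 - t) | t2 in T2 `&` @usphere R d].
have gt : dotp u t <= enorm u * g t.
  have [->|u0] := eqVneq u 0.
    by rewrite enorm0 mul0r -(scale0r 0) dotpZl mul0r.
  rewrite mulrC -ler_pdivrMr ?enorm_gt0 //; apply: lb_le_inf.
    by exists (enorm (t2 - t)), t2.
  move=> _ [s [T2s _] <-]; rewrite ler_pdivrMr ?enorm_gt0 // mulrC.
  rewrite enormBC; apply: le_trans (dotp_le_enorm _ _).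
  by rewrite dotpBr (uT2 s) // subr0.
apply: le_trans gt _; apply: ler_wpM2l; first exact: enorm_ge0.
apply: ub_le_sup; last by exists t.
(* Unit vectors are at distance at most 2, so the set of infima is bounded and the real [sup] is a
   true supremum. *)
exists 2 => _ [s [_ s1] <-].
apply: (@le_trans _ _ (enorm (t2 - s))).
  apply: ge_inf; last by exists t2.
  by exists 0 => _ [v _ <-]; exact: enorm_ge0.
by apply: le_trans (ler_enormD _ _) _; rewrite enormN t21 s1.
Qed.

Definition plane (m : nat) : set 'rV[R]_d :=
  [set y | forall i : 'I_d, (m <= i)%N -> y 0 i = 0].

Lemma plane_line m (y h : 'rV[R]_d) (s : R) :
  plane m y -> plane m h -> plane m (y + s *: h).
Proof. by move=> py ph i mi; rewrite !mxE py // ph // mulr0 addr0. Qed.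

Lemma planeB m (y h : 'rV[R]_d) : plane m y -> plane m h -> plane m (y - h).
Proof. by move=> py ph i mi; rewrite !mxE py // ph // subrr. Qed.

(** The required curve is the image under [Psi] of the line y + t h, which stays in [plane m], for t
    so small that it stays in V. *)
Lemma tangent_chart m M (V : set 'rV[R]_d) (Psi : 'rV[R]_d -> 'rV[R]_d) y h :
  open V -> C1_on V Psi -> (forall z, V z -> M (Psi z) <-> plane m z) ->
  V y -> plane m y -> plane m h -> tangent M (Psi y) ('d Psi y h).
Proof.
move=> oV C1 MV Vy py ph.
have cl (s : R) : {for s, continuous (fun t : R => y + t *: h)}.
  by apply: differentiable_continuous; have [] := diff_line y h s.
have /nbhs_ballP[e e0 eV] : nbhs (0 : R) [set t : R | V (y + t *: h)].
  have := cl 0 V; rewrite /= scale0r addr0; apply.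
  exact: open_nbhs_nbhs.
have {}eV (t : R) : t \in `]- e, e[ -> V (y + t *: h).
  move=> /itvP te; apply: eV; rewrite /ball /= sub0r normrN.
  by rewrite ltr_norml !te.
have dc (t : R) : t \in `]- e, e[ -> is_diff t (fun t : R => Psi (y + t *: h))
      (fun k => 'd Psi (y + t *: h) (k *: h)).
  by move=> te; apply: diff_along_line; have [] := C1 _ (eV _ te).
have e_0 : 0 \in `]- e, e[ by rewrite in_itv /= oppr_lt0 e0.
exists e, (fun t => Psi (y + t *: h)); split=> //.
- move=> t te; split; first by have [] := dc _ te.
  move=> k.
  have c1 : {for t, continuous (fun t : R => 'd Psi (y + t *: h) (k *: h))}.
    apply: (@continuous_comp _ _ _ (fun t : R => y + t *: h)
      (fun z => 'd Psi z (k *: h))); first exact: cl.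
    by have [_ cdPsi] := C1 _ (eV _ te); exact: cdPsi.
  (* The chain rule formula for the differential holds only on the interval, so continuity is
     transferred through equality near t. *)
  apply: near_continuous c1.
  near=> s; have te' : s \in `]- e, e[ by near: s; exact: near_in_itvoo.
  by have [_ ->] := dc s te'.
- by move=> t te; apply/MV; [exact: eV|exact: plane_line].
- by rewrite scale0r addr0.
- have [d0 d0E] := dc _ e_0.
  by rewrite derive1E' // d0E scale1r scale0r addr0.
Unshelve. all: by end_near. Qed.

(** Chain rule for [Phi \o Psi], which is the identity near y because V is open; it yields
    injectivity of ['d Psi y]. *)
Lemma diff_cancel (V U : set 'rV[R]_d) (Psi Phi : 'rV[R]_d -> 'rV[R]_d) y h :
  open V -> C1_on V Psi -> C1_on U Phi ->
  (forall z, V z -> U (Psi z) /\ Phi (Psi z) = z) -> V y ->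
  'd Phi (Psi y) ('d Psi y h) = h.
Proof.
move=> oV C1 C1' UV Vy; have [dPsi _] := C1 _ Vy.
have [UPy _] := UV _ Vy; have [dPhi _] := C1' _ UPy.
have dif : is_diff y Psi ('d Psi y) by apply: DiffDef.
have dig : is_diff (Psi y) Phi ('d Phi (Psi y)) by apply: DiffDef.
have [dc dcE] := is_diff_comp dif dig.
have De := deriveE h dc; rewrite dcE in De.
rewrite -[LHS]/(('d Phi (Psi y) \o 'd Psi y) h) -De.
rewrite (@near_eq_derive _ _ _ _ id); last first.
  near=> z; have [] := UV z => //.
  by near: z; apply: open_nbhs_nbhs.
by rewrite derive_id.
Unshelve. all: by end_near. Qed.

End TangentSpaces.

(** * Local geometry of submanifolds: closedness and the quadratic normal bound *)

Section Submanifold.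
Context {R : realType} {d m : nat}.
Implicit Types (M : set 'rV[R]_d) (x u xi : 'rV[R]_d).

(** As m >= 1, the first basis vector lies in [plane m]; its image under the injective differential
    of a chart is a nonzero tangent vector, to be normalized. *)
Lemma tangent_unit M xi : (1 <= m)%N -> C1_submanifold m M -> M xi ->
  tangent M xi `&` @usphere R d !=set0.
Proof.
move=> m1 [md _ chart] Mxi.
have [U [V [Psi [oU oV Uxi [Phi [C1 C1' VU UV]] MV]]]] := chart _ Mxi.
have [Vy Py] := UV _ Uxi; set y := Phi xi in Vy Py.
pose h : 'rV[R]_d := delta_mx 0 (Ordinal (leq_ltn_trans (leq0n m) md)).
have ph (c : R) : plane m (c *: h).
  move=> i mi; rewrite !mxE eqxx /= (_ : (i == _) = false) ?mulr0 //.
  by apply/eqP => /(congr1 val) /= i0; rewrite i0 leqNgt m1 in mi.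
have py : plane m y by apply/MV => //; rewrite Py.
pose n := enorm ('d Psi y h).
have n0 : n != 0.
  rewrite enorm_eq0; apply/eqP => D0.
  have e := diff_cancel h oV C1 C1' VU Vy.
  have /rowP : h = 0.
    exact: etrans (esym e) (etrans (congr1 ('d Phi (Psi y)) D0) (linear0 _)).
  by move=> /(_ (Ordinal (leq_ltn_trans (leq0n m) md)))/eqP; rewrite !mxE !eqxx oner_eq0.
exists ('d Psi y (n^-1 *: h)); split.
  by rewrite -{1}Py; apply: tangent_chart oV C1 MV Vy py (ph _).
rewrite /usphere /= linearZ enormZ ger0_norm ?mulVf //.
by rewrite invr_ge0 enorm_ge0.
Qed.

(** Within U, M is the common zero set of continuous coordinates of [Phi]: a nonzero coordinate at x
    would stay nonzero near x, where there are points of M. *)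
Lemma locally_closed M xi : C1_submanifold m M -> M xi ->
  exists2 r : R, 0 < r & closed (M `&` [set x | enorm (x - xi) <= r]).
Proof.
move=> [md _ chart] Mxi.
have [U [V [Psi [oU oV Uxi [Phi [C1 C1' VU UV]] MV]]]] := chart _ Mxi.
have /nbhs_enormP[r r0 rU] : nbhs xi U by apply: open_nbhs_nbhs.
(* Halving the radius keeps the closed ball inside U. *)
exists (r / 2); first by rewrite divr_gt0.
move=> x clx.
have xr : enorm (x - xi) <= r / 2.
  by apply: (@closed_eball _ _ xi (r / 2) x) => A /clx [y [[_ yr] Ay]]; exists y.
have Ux : U x by apply: rU; apply: le_lt_trans xr _; lra.
split=> //; have [Vx <-] := UV _ Ux; apply/MV => // i mi.
apply: contrapT => /eqP ne.
have cPhi : {for x, continuous (fun y => Phi y 0 i)}.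
  apply: (@continuous_comp _ _ _ Phi (fun y : 'rV[R]_d => y 0 i)).
    by have [/differentiable_continuous] := C1' _ Ux.
  exact: coord_continuous.
have [y [[My _] [/= ney Uy]]] :
    (M `&` [set y | enorm (y - xi) <= r / 2])
    `&` ([set y | Phi y 0 i != 0] `&` U) !=set0.
  apply: clx; apply: filterI; last exact: open_nbhs_nbhs.
  exact: (cvgr_neq0 _ cPhi ne).
have [Vy Py] := UV _ Uy.
by move: ney; rewrite (_ : Phi y 0 i = 0) ?eqxx //; apply: (MV _ Vy).1 => //; rewrite Py.
Qed.

Lemma quadratic_normal_bound M xi : C11_submanifold m M -> M xi ->
  exists2 K : R, 0 < K & exists2 r : R, 0 < r &
    forall a b u, M a -> M b -> enorm (a - xi) < r -> enorm (b - xi) < r ->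
      (forall t, tangent M a t -> dotp u t = 0) ->
      dotp u (b - a) <= K * enorm u * enorm (b - a) ^+ 2.
Proof.
move=> [m1 C1M lipM] Mxi; have [md _ chart] := C1M.
have [U [V [Psi [oU oV Uxi [Phi [C1 C1' VU UV]] MV]]]] := chart _ Mxi.
have [W [L [oW Wxi L0 dHL]]] := lipM _ Mxi.
have [Vp Pp] := UV _ Uxi; set p := Phi xi in Vp Pp.
have [C C0 [r r0 [rV dPsi lipPsi]]] :=
  C1_locally_lipschitz C1 (open_nbhs_nbhs (conj oV Vp)).
have [C' C'0 [r' r'0 [rU dPhi lipPhi]]] :=
  C1_locally_lipschitz C1' (open_nbhs_nbhs (conj oU Uxi)).
have cPsi : {for p, continuous Psi}.
  by have [/differentiable_continuous] := C1 _ Vp.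
have cPhi : {for xi, continuous Phi}.
  by have [/differentiable_continuous] := C1' _ Uxi.
(* Radii are chosen so that [Phi] is C'-Lipschitz on the q-ball about xi and maps it into the s-ball
   about p, where [Psi] is C-Lipschitz with values in W. By convexity the chart segment between two
   such points stays in the s-ball. *)
have [s s0 [sr sW]] : exists2 s : R, 0 < s &
    s <= r /\ forall y, enorm (y - p) < s -> W (Psi y).
  have /nbhs_enormP[s s0 sW] : nbhs p (Psi @^-1` W).
    by apply: cPsi; rewrite Pp; apply: open_nbhs_nbhs.
  exists (Num.min s r); first by rewrite lt_min s0.
  split; first by rewrite ge_min lexx orbT.
  by move=> y; rewrite lt_min => /andP[/sW].
have [q q0 [qr' qs]] : exists2 q : R, 0 < q &
    q <= r' /\ forall y, enorm (y - xi) < q -> enorm (Phi y - p) < s.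
  have /nbhs_enormP[q q0 qs] : nbhs xi (Phi @^-1` [set y | enorm (y - p) < s]).
    apply: cPhi; apply: open_nbhs_nbhs; split; first exact: open_eball.
    by rewrite /= subrr enorm0.
  exists (Num.min q r'); first by rewrite lt_min q0.
  split; first by rewrite ge_min lexx orbT.
  by move=> y; rewrite lt_min => /andP[/qs].
(* One factor C C' bounds the velocity at the mean value point z, the other the distance from
   [Psi z] to a; L bounds the turning of the tangent spaces between them. *)
exists (L * (C * C') ^+ 2); first by rewrite mulr_gt0 // exprn_gt0 // mulr_gt0.
exists q => // a b u Ma Mb aq bq uTa.
have ar' := lt_le_trans aq qr'; have br' := lt_le_trans bq qr'.
have [Va Pa] := UV _ (rU _ ar'); have [Vb Pb] := UV _ (rU _ br').
have sa := qs _ aq; have sb := qs _ bq.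
have ra := lt_le_trans sa sr; have rb := lt_le_trans sb sr.
have pa : plane m (Phi a) by apply/MV => //; rewrite Pa.
have pb : plane m (Phi b) by apply/MV => //; rewrite Pb.
set h := Phi b - Phi a.
have hle : enorm h <= C' * enorm (b - a) by exact: lipPhi.
have [|t t01] := @dotp_MVT _ _ _ Psi u (Phi a) (Phi b).
  by move=> t t01; have [] := C1 _ (rV _ (eball_convex ra rb t01)).
have t01' : 0 <= t <= 1 by case/andP: t01 => /ltW -> /ltW ->.
rewrite Pa Pb -/h => ->; set z := Phi a + t *: h.
have sz : enorm (z - p) < s by exact: eball_convex.
have rz := lt_le_trans sz sr.
have Vz : V z by exact: rV.
have ph : plane m h by exact: planeB.
have pz : plane m z by exact: plane_line.
have Tz (c : R) : tangent M (Psi z) (c *: 'd Psi z h).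
  rewrite -linearZ; apply: tangent_chart oV C1 MV Vz pz _.
  by rewrite -[_ *: _]add0r; apply: plane_line => // i _; rewrite mxE.
have Mz : M (Psi z) by apply/MV.
have nba := enorm_ge0 (b - a); have nu := enorm_ge0 u.
(* A zero velocity cannot be normalized, but then the left side is 0. *)
have [->|v0] := eqVneq ('d Psi z h) 0.
  by rewrite -(scale0r 0) dotpZr mul0r !mulr_ge0 // ?ltW // exprn_ge0 // mulr_ge0 // ltW.
pose n := enorm ('d Psi z h).
have n0 : 0 < n by rewrite enorm_gt0.
have nle : n <= C * C' * enorm (b - a).
  by rewrite -mulrA; apply: le_trans (dPsi _ _ rz) _; rewrite ler_pM2l.
have za : enorm (Psi z - a) <= C * C' * enorm (b - a).
  rewrite -[X in _ - X]Pa -mulrA; apply: le_trans (lipPsi _ _ ra rz) _.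
  rewrite ler_pM2l //; apply: le_trans hle.
  rewrite /z addrC addrA addNr add0r enormZ ger0_norm; last by case/andP: t01'.
  by rewrite ler_piMl ?enorm_ge0 //; case/andP: t01'.
have dHza : dH (tangent M (Psi z)) (tangent M a) <= L * enorm (Psi z - a).
  apply: dHL; split => //; first exact: sW.
  by rewrite -Pa; exact: sW.
(* The normalized velocity is a unit tangent vector at [Psi z], compared through [dH] with the
   tangent space at a, to which u is normal. *)
have unit_le : dotp u (n^-1 *: 'd Psi z h) <= enorm u * (L * (C * C' * enorm (b - a))).
  apply: le_trans (dotp_le_dH (tangent_unit m1 C1M Ma) (Tz _) _ uTa) _.
    by rewrite enormZ ger0_norm ?invr_ge0 ?ltW // mulVf // gt_eqF.
  by rewrite ler_wpM2l // (le_trans dHza) // ler_pM2l.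
rewrite dotpZr ler_pdivrMl // in unit_le.
apply: le_trans unit_le _.
set D := enorm (b - a) in nle nba *.
rewrite (_ : L * _ * _ * _ = (C * C' * D) * (enorm u * (L * (C * C' * D)))); last by ring.
by rewrite ler_wpM2r // !mulr_ge0 // ltW.
Qed.

End Submanifold.

(** * Nearest points, distance, tubes and normal segments *)

Section NearestPoints.
Context {R : realType} {d : nat}.
Implicit Types (M A : set 'rV[R]_d) (x y xi v : 'rV[R]_d).

Definition nearest A x xi :=
  A xi /\ forall eta, A eta -> enorm (x - xi) <= enorm (x - eta).

(** Only the part of A in the ball about x through y matters, and it is compact. Closedness is asked
    of that part alone, so that the lemma applies to a locally closed M. *)
Lemma nearest_exists A x y : A y ->
  closed (A `&` [set z | enorm (z - x) <= enorm (y - x)]) ->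
  exists xi, nearest A x xi.
Proof.
move=> Ay cA.
have cptA := compact_eball cA (@subIsetr _ _ _).
have [||xi /set_mem[Axi xiy] minxi] :=
    EVT_min_rV (f := fun z => enorm (z - x)) _ cptA.
- by exists y; split => //=.
- by apply: continuous_subspaceT => z; exact: continuous_edist.
exists xi; split=> // eta Aeta; rewrite !(enormBC x).
have [le|/ltW] := leP (enorm (eta - x)) (enorm (y - x)); last exact: le_trans.
by apply: minxi; apply/mem_set.
Qed.

Lemma nearest_closed A x : closed A -> A !=set0 -> exists xi, nearest A x xi.
Proof.
move=> cA [y Ay]; apply: nearest_exists Ay _.
by apply: closedI => //; exact: closed_eball.
Qed.

Lemma dist_le A x xi : A xi -> dist x A <= enorm (x - xi).
Proof.
move=> Axi; apply: ge_inf; last by exists xi.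
by exists 0 => _ [y _ <-]; exact: enorm_ge0.
Qed.

Lemma dist_nearest A x xi : nearest A x xi -> dist x A = enorm (x - xi).
Proof.
move=> [Axi min]; apply/le_anti; rewrite dist_le //=.
by apply: lb_le_inf; [exists (enorm (x - xi)), xi|move=> _ [y Ay <-]; exact: min].
Qed.

Lemma tubeP A e x : A !=set0 ->
  tube A e x <-> exists2 xi, A xi & enorm (x - xi) < e.
Proof.
move=> [y Ay]; split=> [/inf_lt[]|[xi Axi]]; last exact/le_lt_trans/dist_le.
  by exists (enorm (x - y)), y.
by move=> _ [xi Axi <-]; exists xi.
Qed.

Lemma dist_lipschitz A x y : A !=set0 -> dist x A <= dist y A + enorm (x - y).
Proof.
move=> [z Az]; rewrite -lerBlDr; apply: lb_le_inf; first by exists (enorm (y - z)), z.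
move=> _ [c Ac <-]; rewrite lerBlDr; apply: le_trans (dist_le x Ac) _.
by rewrite [leRHS]addrC; apply: le_trans (ler_enormD _ _); rewrite addrA subrK.
Qed.

Lemma continuous_dist A : A !=set0 -> continuous (fun x => dist x A).
Proof.
move=> A0 x; apply/(cvgrPdist_lt (FF := nbhs_filter x)) => e e0; apply/nbhs_enormP.
exists e => // y yx; apply: le_lt_trans yx; rewrite ler_norml.
have := dist_lipschitz x y A0; have := dist_lipschitz y x A0.
by rewrite (enormBC x); lra.
Qed.

Lemma unpp_nearest M x xi : nearest M x xi ->
  (forall eta, nearest M x eta -> eta = xi) -> unpp M x.
Proof.
move=> nxi uniq; exists xi; split; first by split; [case: nxi|rewrite (dist_nearest nxi)].
move=> eta [Meta e]; symmetry; apply: uniq; split=> // z Mz.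
by rewrite e; exact: dist_le.
Qed.

Lemma nearest_unit_normal M x xi : nearest M x xi -> x != xi ->
  unit_normal M (xi, (enorm (x - xi))^-1 *: (x - xi)).
Proof.
move=> [Mxi min] xxi; split=> //= [t Tt|].
  by rewrite dotpZl (nearest_normal min Tt) mulr0.
rewrite enormZ ger0_norm ?invr_ge0 ?enorm_ge0 // mulVf //.
by rewrite enorm_eq0 subr_eq0.
Qed.

Lemma open_segment_ray xi v (r s : R) : 0 < r -> r < s ->
  open_segment xi (xi + s *: v) (xi + r *: v).
Proof.
move=> r0 rs; have s0 := lt_trans r0 rs; exists (r / s).
  by rewrite /= in_itv /= divr_gt0 //= ltr_pdivrMr // mul1r.
apply/rowP => i; rewrite !mxE; field; exact: lt0r_neq0.
Qed.

Lemma frontier_fun_ge M xi v (r : R) : 0 < r -> enorm v = 1 ->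
  (forall y, enorm (y - xi) < r -> unpp_int M y) ->
  (r%:E <= frontier_fun M (xi, v))%E.
Proof.
move=> r0 v1 rM; apply: ereal_sup_ubound; exists r => //; split=> // _ [l /= l01 <-].
move: l01; rewrite in_itv /= => /andP[l0 l1]; apply: rM.
have -> : (1 - l) *: xi + l *: (xi + r *: v) - xi = (l * r) *: v.
  by apply/rowP => i; rewrite !mxE; ring.
by rewrite enormZ v1 mulr1 ger0_norm ?mulr_ge0 ?ltW // gtr_pMl.
Qed.

(** A tube is a union of open balls, so it lies in the interior of any set containing it. *)
Lemma tube_sub_unpp_int M e : M !=set0 ->
  tube M e `<=` unpp M -> tube M e `<=` unpp_int M.
Proof.
move=> M0 Me x /tubeP-/(_ M0)[xi Mxi xe].
apply: (@filterS _ _ _ [set y | enorm (y - xi) < e]).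
  by move=> y ye; apply: Me; apply/tubeP => //; exists xi.
by apply: open_nbhs_nbhs; split => //; exact: open_eball.
Qed.

End NearestPoints.

(** * Comparison of the reach with the frontier function *)

Section Reach.
Context {R : realType} {d m : nat}.
Implicit Types (M : set 'rV[R]_d).

Lemma submanifold_sub_unpp_int M : C11_submanifold m M -> M `<=` unpp_int M.
Proof.
move=> hM xi Mxi; have [_ C1M _] := hM.
have [K K0 [r r0 quad]] := quadratic_normal_bound hM Mxi.
have [r' r'0 clM] := locally_closed C1M Mxi.
(* The bound r/2 puts all nearest points of x within r of xi; r'/2 puts the ball about x through xi
   where M is closed; 1/(4K) gives K |x - a| <= 1/4. *)
apply/nbhs_enormP; exists (Num.min (r / 2) (Num.min (r' / 2) (K * 4)^-1)).
  by rewrite !lt_min !divr_gt0 // invr_gt0 mulr_gt0.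
move=> x; rewrite !lt_min => /and3P[xr xr' xK].
have [a na] : exists a, nearest M x a.
  apply: nearest_exists Mxi _; rewrite (enormBC xi).
  rewrite (_ : _ `&` _ = M `&` [set y | enorm (y - xi) <= r'] `&`
      [set z | enorm (z - x) <= enorm (x - xi)]).
    by apply: closedI => //; exact: closed_eball.
  apply/seteqP; split => [y [My /= yx]|y [[My _] yx]] //.
  split=> //; split=> //=; have := ler_enormB y xi x.
  by rewrite (enormBC xi); lra.
have near_r b : nearest M x b -> enorm (b - xi) < r.
  move=> [_ /(_ _ Mxi)]; have := ler_enormB b xi x.
  by rewrite (enormBC xi) (enormBC b x); lra.
apply: (unpp_nearest na) => b nb.
have [[Ma amin] [Mb bmin]] := (na, nb).
have ab : enorm (x - b) = enorm (x - a) by apply/le_anti; rewrite amin // bmin.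
have := quad a b (x - a) Ma Mb (near_r _ na) (near_r _ nb) (fun t => nearest_normal amin).
have sq : enorm (x - b) ^+ 2 =
    enorm (x - a) ^+ 2 - 2 * dotp (x - a) (b - a) + enorm (b - a) ^+ 2.
  have -> : x - b = (x - a) - (b - a) by rewrite opprB addrA subrK.
  rewrite !enorm_sqr !(dotpBl (x - a) (b - a)) !(dotpBr _ (x - a) (b - a)).
  by rewrite (dotpC (b - a) (x - a)); ring.
have KN : K * enorm (x - a) <= 4^-1.
  rewrite mulrC -ler_pdivlMr // -invfM mulrC.
  by apply: le_trans (amin _ Mxi) _; exact: ltW.
rewrite ab in sq => le2.
have ba0 := sqr_ge0 (enorm (b - a)).
(* Equal distances make <x - a, b - a> half of |b - a|^2, while the quadratic bound makes it at most
   a quarter. *)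
have : enorm (b - a) ^+ 2 <= 0 by have := ler_wpM2r ba0 KN; lra.
rewrite le_eqVlt ltNge ba0 orbF expf_eq0 /= enorm_eq0 subr_eq0.
by move/eqP.
Qed.

Lemma reach_le_frontier M p : C11_submanifold m M -> unit_normal M p ->
  (reach M <= frontier_fun M p)%E.
Proof.
move=> hM; case: p => xi v [/= Mxi _ v1]; have [_ [_ M0 _] _] := hM.
rewrite /reach ge_max; apply/andP; split.
  (* The term 0 in the definition of [reach] requires the frontier function to be nonnegative; a
     ball about xi inside E(M) provides this. *)
  have /nbhs_enormP[r r0 rM] : nbhs xi (unpp_int M).
    apply: open_nbhs_nbhs; split; first exact: open_interior.
    exact: submanifold_sub_unpp_int hM _ Mxi.
  by apply: le_trans (frontier_fun_ge r0 v1 rM); rewrite lee_fin ltW.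
apply: ge_ereal_sup => _ [e [e0 eM] <-]; apply: frontier_fun_ge => // y ye.
by apply: tube_sub_unpp_int eM _ _ => //; apply/tubeP => //; exists xi.
Qed.

Lemma reach_ge M (e : R) : 0 < e -> tube M e `<=` unpp M -> (e%:E <= reach M)%E.
Proof.
move=> e0 eM; rewrite /reach le_max; apply/orP; right.
by apply: ereal_sup_ubound; exists e.
Qed.

Lemma tube_sub_unpp M (e : R) : C11_submanifold m M -> closed M ->
  (e%:E <= ereal_inf [set frontier_fun M p | p in unit_normal M])%E ->
  tube M e `<=` unpp M.
Proof.
move=> hM cM e_le x; have [_ [_ M0 _] _] := hM.
move=> /tubeP-/(_ M0)[eta Meta xe].
have [xi nxi] := nearest_closed x cM M0; have [Mxi min] := nxi.
have [->|xxi] := eqVneq x xi.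
  by apply: interior_subset; exact: submanifold_sub_unpp_int hM _ Mxi.
set r := enorm (x - xi); pose v := r^-1 *: (x - xi).
have r0 : 0 < r by rewrite enorm_gt0 subr_eq0.
have : (r%:E < frontier_fun M (xi, v))%E.
  apply: (@lt_le_trans _ _ e%:E).
    by rewrite lte_fin; apply: le_lt_trans (min _ Meta) xe.
  apply: le_trans e_le (ereal_inf_lbound _).
  by exists (xi, v) => //; exact: nearest_unit_normal.
(* An admissible length s > r is needed because x, at parameter r, must lie in the open segment. *)
move=> /ereal_sup_gt[_ [s [s0 sM] <-]]; rewrite lte_fin => rs.
apply: interior_subset; apply: sM.
have -> : x = xi + r *: v.
  by rewrite scalerA mulfV ?scale1r ?gt_eqF // addrC subrK.
exact: open_segment_ray.
Qed.

Lemma ereal_inf_le_reach M : C11_submanifold m M -> closed M ->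
  (ereal_inf [set frontier_fun M p | p in unit_normal M] <= reach M)%E.
Proof.
move=> hM cM.
have rge (e : R) : 0 < e ->
    (e%:E <= ereal_inf [set frontier_fun M p | p in unit_normal M])%E ->
    (e%:E <= reach M)%E.
  by move=> e0 /(tube_sub_unpp hM cM); exact: reach_ge.
have r0 : (0 <= reach M)%E by rewrite /reach le_max lexx.
(* A positive finite infimum is itself an admissible tube radius; if it is infinite, every positive
   real is. *)
case E : (ereal_inf _) => [e| |]; last exact: leNye.
  have [e0|e0] := ltP 0 e; first by apply: rge; rewrite // E.
  by apply: le_trans r0; rewrite lee_fin.
suff -> : reach M = +oo%E by [].
by apply/eqyP => e e0; apply: rge; rewrite // E leey.
Qed.

Lemma compact_frontier_le_reach M : C11_submanifold m M -> compact M ->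
  (exists2 p, unit_normal M p & (frontier_fun M p <= reach M)%E) /\
  (0 < reach M)%E.
Proof.
move=> hM cptM; have [m1 C1M _] := hM; have [_ M0 _] := C1M.
have cM : closed M by apply: compact_closed cptM; exact: norm_hausdorff.
have oE : open (unpp_int M) by exact: open_interior.
(* If E(M) is the whole space, the reach is infinite and any unit normal will do. One is obtained
   from a point of norm exceeding the maximum on M and a nearest point of M to it. *)
have [[z nEz]|allE] := pselect (exists z, ~ unpp_int M z); last first.
  have sub (e : R) : tube M e `<=` unpp M.
    move=> x _; apply: interior_subset; apply: contrapT => nE.
    by apply: allE; exists x.
  have ry : reach M = +oo%E by apply/eqyP => e e0; exact: reach_ge.
  rewrite ry; split; last exact: ltry.
  have [c _ cmax] := EVT_max_rV M0 cptM (continuous_subspaceT (@continuous_enorm _ _)).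
  have [xi0 Mxi0] := M0; have [h [_ h1]] := tangent_unit m1 C1M Mxi0.
  pose x := (enorm c + 1) *: h.
  have nMx : ~ M x.
    move=> /mem_set/cmax; rewrite enormZ h1 mulr1 ger0_norm; first lra.
    by rewrite addr_ge0 // enorm_ge0.
  have [xi nxi] := nearest_closed x cM M0.
  exists (xi, (enorm (x - xi))^-1 *: (x - xi)); last exact: leey.
  apply: nearest_unit_normal => //; apply: contra_notN nMx => /eqP ->.
  by case: nxi.
have C0 : ~` unpp_int M !=set0 by exists z.
have [xi /set_mem Mxi minxi] :=
  EVT_min_rV M0 cptM (continuous_subspaceT (continuous_dist C0)).
have [c nc] := nearest_closed xi (open_closedC oE) C0.
have [nEc _] := nc; have dc := dist_nearest nc.
have cxi : c != xi.
  apply: contra_notN nEc => /eqP ->.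
  exact: submanifold_sub_unpp_int hM _ Mxi.
set r := enorm (c - xi).
have r0 : 0 < r by rewrite enorm_gt0 subr_eq0.
have rC eta y : M eta -> enorm (y - eta) < r -> unpp_int M y.
  move=> Meta yr; apply: contrapT => nEy.
  have := minxi eta (mem_set Meta); have := dist_le (A := ~` unpp_int M) eta nEy.
  by rewrite dc (enormBC xi) (enormBC eta) -/r; lra.
(* A point of M closer to c than r would force c into E(M), since r is the least distance from M to
   the complement. Hence c - xi is normal at xi. *)
have nxi : nearest M c xi.
  split=> // eta Meta; rewrite leNgt; apply/negP => lt.
  by apply: nEc; exact: rC Meta lt.
have rr : (r%:E <= reach M)%E.
  apply: reach_ge => // y /tubeP-/(_ M0)[eta Meta ye].
  by apply: interior_subset; exact: rC Meta ye.
split; last by apply: lt_le_trans rr; rewrite lte_fin.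
exists (xi, r^-1 *: (c - xi)); first exact: nearest_unit_normal.
(* A segment of length s > r in this direction contains c, which is not in E(M); thus the frontier
   function is at most r here. *)
apply: le_trans rr; apply: ge_ereal_sup => _ [s [s0 sM] <-].
rewrite lee_fin leNgt; apply/negP => rs; apply: nEc; apply: sM.
have := open_segment_ray xi (r^-1 *: (c - xi)) r0 rs.
rewrite [X in open_segment _ _ (_ + X)]scalerA mulfV ?gt_eqF // scale1r.
by rewrite addrCA subrr addr0.
Qed.

End Reach.

Theorem proposition6 (R : realType) (d m : nat) (M : set 'rV[R]_d)
    (hM : C11_submanifold m M) :
  [/\ (reach M <= ereal_inf [set frontier_fun M p | p in unit_normal M])%E,
      closed M ->
        reach M = ereal_inf [set frontier_fun M p | p in unit_normal M]
    & compact M ->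
        (exists p, [/\ unit_normal M p, reach M = frontier_fun M p
           & forall q, unit_normal M q ->
               (frontier_fun M p <= frontier_fun M q)%E])
        /\ (0 < reach M)%E].
Proof.
have le_inf : (reach M <= ereal_inf [set frontier_fun M p | p in unit_normal M])%E.
  by apply: le_ereal_inf_tmp => _ [p np <-]; exact: reach_le_frontier hM np.
split=> // [cM|cptM]; first by apply/le_anti; rewrite le_inf (ereal_inf_le_reach hM).
have [[p np ple] r0] := compact_frontier_le_reach hM cptM.
split=> //; exists p.
have rp : reach M = frontier_fun M p by apply/le_anti; rewrite ple (reach_le_frontier hM).
by split=> // q nq; rewrite -rp; exact: reach_le_frontier hM nq.
Qed.
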